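(* Let $X$ be a finite set with conductances $c_{xy}$ forming a connected resistance network, let $\mathcal{A}=C(X)$ with state space $S(\mathcal{A})$, and let $\rho_r=\rho_{\mathcal{E}}^2$ on $S(\mathcal{A})\times S(\mathcal{A})$, where $\rho_{\mathcal{E}}$ is the energy metric of the network. Identify $X$ with the set of extreme points of $S(\mathcal{A})$ (each point corresponding to evaluation at it). Then no subset of $S(\mathcal{A})$ that properly contains $X$ has the property that the restriction of $\rho_r$ to it is a metric.
   Context: $C(X)$ is the $C^*$-algebra of complex-valued functions on $X$; $S(\mathcal{A})$ is the set of positive linear functionals $\mu$ on $\mathcal{A}$ with $\mu(1)=1$. A resistance network on $X$ is given by real numbers $c_{xy}=c_{yx}\geq 0$ for $x\ne y$ in $X$; it is connected if the graph with vertex set $X$ and with an edge between $x\neq y$ exactly when $c_{xy}\neq 0$ is connected. Its energy form is $$\mathcal{E}(f,g)=\tfrac12\sum_{x\neq y}(\bar f(x)-\bar f(y))(g(x)-g(y))c_{xy}\qquad (f,g\in C(X)),$$ and its energy metric on $S(\mathcal{A})$ is $$\rho_{\mathcal{E}}(\mu,\nu)=\sup\{|\mu(f)-\nu(f)| : f\in\mathcal{A},\ \mathcal{E}(f,f)^{1/2}\leq 1\}.$$ On $X$ the function $\rho_r=\rho_{\mathcal{E}}^2$ is the resistance metric: $\rho_r(p,q)=h_{pq}(p)-h_{pq}(q)$, where $h_{pq}$ is the function with $\sum_{x\in X} h_{pq}(x)=0$ and $\Delta h_{pq}=\delta_p-\delta_q$, with $(\Delta f)(x)=\sum_y(f(x)-f(y))c_{xy}$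 the Laplace operator of the network. *)

(* Defs.v *)
From HB Require Import structures.
From mathcomp Require Import all_boot all_order all_algebra.
From mathcomp Require Import complex.
From mathcomp Require Import all_classical all_reals ereal.

Set Implicit Arguments.
Unset Strict Implicit.
Unset Printing Implicit Defensive.

Import Order.TTheory GRing.Theory Num.Theory.

Local Open Scope classical_set_scope.
Local Open Scope complex_scope.
Local Open Scope ring_scope.

Section Network.
Variables (R : realType) (X : finType).

Definition resistance_network (c : X -> X -> R) : Prop :=
  forall x y, x != y -> c x y = c y x /\ 0 <= c x y.

Definition connected_network (c : X -> X -> R) : Prop :=
  forall x y, connect [rel u v | (u != v) && (c u v != 0)] x y.

Definition functional := {ffun X -> R[i]} -> R[i].

(* The order on R[i] is partial: 0 <= z means that z is real and nonnegative.
   In C(X), f is positive iff its spectrum, i.e. its range, is nonnegative. *)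
Definition state_space : set functional :=
  [set mu | [/\ scalar mu,
                (forall f : {ffun X -> R[i]}, (forall x, 0 <= f x) -> 0 <= mu f)
              & mu 1 = 1]].

Definition evaluation (x : X) : functional := fun f => f x.

Definition energy (c : X -> X -> R) (f g : {ffun X -> R[i]}) : R[i] :=
  2^-1 * \sum_x \sum_(y | x != y)
    ((f x)^* - (f y)^*) * (g x - g y) * (c x y)%:C.

Definition energy_metric (c : X -> X -> R) (mu nu : functional) : \bar R :=
  ereal_sup [set (ComplexField.Normc.normc (mu f - nu f))%:E | f in
    [set f : {ffun X -> R[i]} | sqrtC (energy c f f) <= 1]].

Definition resistance_metric (c : X -> X -> R) (mu nu : functional) : \bar R :=
  (energy_metric c mu nu ^+ 2)%E.

(* Finite-valued: the suprema above are taken in \bar R only so that no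
   default value stands in for the supremum of an unbounded set. *)
Definition metric_on (T : Type) (A : set T) (d : T -> T -> \bar R) : Prop :=
  [/\ forall x y, A x -> A y -> d x y \is a fin_num /\ (0 <= d x y)%E,
      forall x y, A x -> A y -> (d x y = 0%E <-> x = y),
      forall x y, A x -> A y -> d x y = d y x
    & forall x y z, A x -> A y -> A z -> (d x z <= d x y + d y z)%E].

Definition extreme_points (K : set functional) : set functional :=
  [set phi | K phi /\
    forall (mu nu : functional) (t : R), K mu -> K nu -> 0 < t < 1 ->
      (forall f, phi f = t%:C * mu f + (1 - t)%:C * nu f) ->
      mu = phi /\ nu = phi].

Implicit Types (phi mu : functional) (f : {ffun X -> R[i]}) (x y : X).

Let bump_at x : {ffun X -> R[i]} := [ffun y => (y == x)%:R].

Let statesB mu : state_space mu ->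
  (forall f, mu f = \sum_x f x * mu (bump_at x)) /\
  (forall x, 0 <= mu (bump_at x)) /\ \sum_x mu (bump_at x) = 1.
Proof.
move=> [mulin mupos mu1].
have muE f : mu f = \sum_x f x * mu (bump_at x).
  have mu0 : mu 0 = 0.
    by have := mulin (-1) 0 0; rewrite scaleN1r addNr mulN1r addNr.
  have fE : f = \sum_x f x *: bump_at x.
    apply/ffunP => y; rewrite sum_ffunE (bigD1 y)//= !ffunE eqxx.
    rewrite [X in _ + X]big1 => [|x xy]; first by rewrite addr0 [RHS]mulr1.
    by rewrite !ffunE eq_sym (negbTE xy) [LHS]mulr0.
  rewrite {1}fE; apply: (big_ind2 (fun g r => mu g = r)) => //.
  - move=> f1 r1 f2 r2 <- <-.
    by have := mulin 1 f1 f2; rewrite scale1r mul1r.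
  - by move=> x _; have := mulin (f x) (bump_at x) 0; rewrite addr0 mu0 addr0.
split=> //; split.
  by move=> x; apply: mupos => y; rewrite ffunE; case: (y == x).
by rewrite -mu1 muE; apply: eq_bigr => x _; rewrite ffunE mul1r.
Qed.

Let state_concentrated mu x : state_space mu ->
  (forall y, y != x -> mu (bump_at y) = 0) -> mu = evaluation x.
Proof.
move=> /statesB[muE [_ mu1]] mu0; apply/funext => f.
have mux : mu (bump_at x) = 1.
  by rewrite -mu1 (bigD1 x)//= big1 ?addr0.
by rewrite muE (bigD1 x)//= big1 ?addr0 ?mux ?mulr1// => y /mu0->; rewrite mulr0.
Qed.

Lemma evaluation_state x : state_space (evaluation x).
Proof.
by split=> [a f g|f|]; rewrite /evaluation ?ffunE.
Qed.

(* The identification of X with the set of extreme points of the state space. *)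
Lemma extreme_points_state_space :
  extreme_points state_space = range evaluation.
Proof.
apply/seteqP; split=> [phi [phiS phiext]|_ [x _ <-]]; last first.
  split; first exact: evaluation_state.
  move=> mu nu t muS nuS /andP[t0 t1] E.
  have [_ [mupos _]] := statesB muS; have [_ [nupos _]] := statesB nuS.
  have t0' : 0 < t%:C by rewrite ltcR.
  have t1' : 0 < (1 - t)%:C by rewrite ltcR subr_gt0.
  suff H y : y != x -> mu (bump_at y) = 0 /\ nu (bump_at y) = 0.
    by split; apply: state_concentrated => // y /H[].
  move=> yx; have /esym/eqP := E (bump_at y).
  have /negbTE xy : x != y by rewrite eq_sym.
  rewrite /evaluation ffunE xy paddr_eq0; try
    by rewrite mulr_ge0 ?mupos ?nupos ?(ltW t0') ?(ltW t1').
  by rewrite !mulf_eq0 (gt_eqF t0') (gt_eqF t1')/= => /andP[/eqP-> /eqP->].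
have [phiE [phipos phi1]] := statesB phiS.
have [x phix] : exists x, phi (bump_at x) != 0.
  apply/existsP; apply: contraT => /existsPn H.
  move: phi1; rewrite big1 => [/eqP|x _]; first by rewrite eq_sym oner_eq0.
  by apply/eqP; have := H x; rewrite negbK.
exists x => //.
have [t tE] : exists t : R, phi (bump_at x) = t%:C.
  by exists (complex.Re (phi (bump_at x))); rewrite RRe_real// ger0_real.
have t0 : 0 < t by rewrite -ltcR -tE lt_def phix phipos.
have sumx : phi (bump_at x) + \sum_(y | y != x) phi (bump_at y) = 1.
  by rewrite -phi1 [RHS](bigD1 x).
have rest0 : 0 <= \sum_(y | y != x) phi (bump_at y) by exact: sumr_ge0.
have t1 : t <= 1 by rewrite -lecR -tE -[leRHS]sumx lerDl.
move: t1; rewrite le_eqVlt => /orP[/eqP t1|t1].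
  apply/esym/state_concentrated => // y yx; apply/eqP.
  have : \sum_(y | y != x) phi (bump_at y) == 0.
    by rewrite -(inj_eq (addrI (phi (bump_at x)))) sumx addr0 tE t1.
  by rewrite psumr_eq0// => /allP/(_ y (mem_index_enum y))/implyP/(_ yx).
have s0 : 0 < (1 - t)%:C by rewrite ltcR subr_gt0.
pose nu : functional := fun f => ((1 - t)%:C)^-1 * (phi f - t%:C * f x).
have nuS : state_space nu.
  case: phiS => philin _ phione; split.
  - move=> a f g; rewrite /nu philin !ffunE.
    rewrite [a * (_ * _)]mulrCA -mulrDr; congr (_ * _).
    by rewrite !mulrDr opprD addrACA mulrN mulrCA.
  - move=> f f0; rewrite /nu mulr_ge0 ?invr_ge0 ?(ltW s0)// phiE (bigD1 x)//= tE.
    by rewrite mulrC addrAC subrr add0r sumr_ge0// => y _; exact: mulr_ge0.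
  - rewrite /nu phione ffunE mulr1.
    have -> : 1 - t%:C = (1 - t)%:C by rewrite rmorphB.
    by rewrite mulVf ?gt_eqF.
have [] // := phiext (evaluation x) nu t (evaluation_state x) nuS;
  first exact/andP.
by move=> f; rewrite /nu mulrA mulfV ?gt_eqF// mul1r /evaluation addrC subrK.
Qed.

End Network.
Arguments evaluation {R X} x.

(* Main.v *)
Require Import Defs.
From mathcomp Require Import all_boot all_order all_algebra.
From mathcomp Require Import complex.
From mathcomp Require Import all_classical all_reals ereal.
From mathcomp Require Import ring lra.

Local Open Scope classical_set_scope.

(** The energy metric is a Hilbert space distance: the Dirichlet form makes real
functions modulo constants a Euclidean space, and the difference of two states
with weights m and n is represented in it by the solution w of the Poisson
equation [laplacian w = m - n] ([poisson_solvable]), so that the squared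
distance of the two states is the Dirichlet energy of w ([resistance_metricE]).

By the law of cosines, the squared distance satisfies the triangle inequality at
a triangle x, mu, p exactly when its angle at mu is not obtuse.  A state mu is
the barycentre of the point evaluations with weights m, hence the vectors from
mu to the points x, weighted by m, add up to zero.  Taking the inner product
with the vector from mu to a point p gives a sum of weighted inner products
equal to 0.  If no angle at mu is obtuse, then all its terms are nonnegative, so
they all vanish; for p with [m p != 0] the term at [x = p] forces the distance
from p to mu to be 0 ([triangles_through_state]).  A metric separates points, so
when the squared distance is a metric on a set of states containing X, every
element of this set is an evaluation. *)

(** * The Dirichlet form and the Laplacian on real functions *)

Section DirichletForm.
Import Order.TTheory GRing.Theory Num.Theory.
Local Open Scope ring_scope.
Context {R : realType} {X : finType}.
Implicit Types (c : X -> X -> R) (a b u v w : X -> R).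

(** The diagonal terms vanish, so the sums can range over all pairs. *)
Definition dirichlet c a b : R :=
  2^-1 * \sum_x \sum_y (a x - a y) * (b x - b y) * c x y.

Definition laplacian c a x : R := \sum_y (a x - a y) * c x y.

Lemma dirichletC c a b : dirichlet c a b = dirichlet c b a.
Proof.
congr (_ * _); apply: eq_bigr => x _; apply: eq_bigr => y _.
by rewrite [(a x - a y) * _]mulrC.
Qed.

Lemma dirichlet_lin c t a a' b :
  dirichlet c (fun x => a x + t * a' x) b
  = dirichlet c a b + t * dirichlet c a' b.
Proof.
rewrite /dirichlet [t * _]mulrCA -mulrDr [t * _]mulr_sumr -big_split.
congr (_ * _); apply: eq_bigr => x _ /=; rewrite mulr_sumr -big_split.
by apply: eq_bigr => y _ /=; ring.
Qed.

Lemma dirichlet_quad c t a b :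
  dirichlet c (fun x => a x + t * b x) (fun x => a x + t * b x)
  = dirichlet c a a + 2 * t * dirichlet c a b + t ^+ 2 * dirichlet c b b.
Proof.
pose q x := a x + t * b x; rewrite dirichlet_lin -/q.
rewrite (dirichletC c a q) (dirichletC c b q) !dirichlet_lin.
by rewrite (dirichletC c b a); ring.
Qed.

Lemma dirichletZ c t a b :
  dirichlet c (fun x => t * a x) b = t * dirichlet c a b.
Proof.
rewrite /dirichlet [RHS]mulrCA [t * _]mulr_sumr.
congr (_ * _); apply: eq_bigr => x _; rewrite mulr_sumr.
by apply: eq_bigr => y _ /=; ring.
Qed.

Lemma laplacian_lin c t a b x :
  laplacian c (fun y => a y + t * b y) x
  = laplacian c a x + t * laplacian c b x.
Proof.
rewrite /laplacian mulr_sumr -big_split.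
by apply: eq_bigr => y _ /=; ring.
Qed.

Section Network.
Variable (c : X -> X -> R).
Hypothesis c_network : resistance_network c.

Lemma conductance_sym x y : c x y = c y x.
Proof. by have [->//|/c_network[]] := eqVneq x y. Qed.

Lemma dirichlet_term_ge0 a x y : 0 <= (a x - a y) * (a x - a y) * c x y.
Proof.
have [->|/c_network[_ c0]] := eqVneq x y; first by rewrite subrr !mul0r.
by rewrite mulr_ge0// -expr2 sqr_ge0.
Qed.

Lemma dirichlet_ge0 a : 0 <= dirichlet c a a.
Proof.
rewrite mulr_ge0 ?invr_ge0//.
by do 2![apply: sumr_ge0 => ? _]; exact: dirichlet_term_ge0.
Qed.

(** Summation by parts: swapping the names of x and y in the terms with [a y]
turns them into those with [a x]; this uses the symmetry of c. *)
Lemma green a b : dirichlet c a b = \sum_x a x * laplacian c b x.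
Proof.
have E : \sum_x \sum_y (a x - a y) * (b x - b y) * c x y
    = \sum_x a x * laplacian c b x + \sum_x a x * laplacian c b x.
  under [X in _ = X + _]eq_bigr do rewrite mulr_sumr.
  under [X in _ = _ + X]eq_bigr do rewrite mulr_sumr.
  rewrite [X in _ = _ + X]exchange_big -big_split/=; apply: eq_bigr => x _.
  rewrite -big_split/=; apply: eq_bigr => y _.
  by rewrite [c y x]conductance_sym; ring.
by rewrite /dirichlet E; field.
Qed.

Lemma cauchy_schwarz a b :
  dirichlet c a b ^+ 2 <= dirichlet c a a * dirichlet c b b.
Proof.
have H t : 0 <= dirichlet c a a + 2 * t * dirichlet c a b
                + t ^+ 2 * dirichlet c b b.
  by rewrite -dirichlet_quad dirichlet_ge0.
have := dirichlet_ge0 b; set B := dirichlet c b b in H *.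
set A := dirichlet c a a in H *; set C := dirichlet c a b in H *.
rewrite le_eqVlt => /orP[/eqP B0|B0].
  have [->|C0] := eqVneq C 0; first by rewrite expr0n/= -B0 mulr0.
  (* The polynomial in H is affine in t; at this t its value would be -1. *)
  have := H (- (A + 1) / (2 * C)); rewrite -B0 mulr0 addr0.
  have -> : 2 * (- (A + 1) / (2 * C)) * C = - (A + 1) by field.
  lra.
(* The minimum over t of the quadratic polynomial in H. *)
have := H (- C / B).
have -> : A + 2 * (- C / B) * C + (- C / B) ^+ 2 * B = (A * B - C ^+ 2) / B.
  by field; rewrite gt_eqF.
by rewrite pmulr_lge0 ?invr_gt0// subr_ge0.
Qed.

Hypothesis c_connected : connected_network c.

(** A harmonic function has zero energy, so it takes the same value at the two
ends of each edge, and then everywhere by connectedness. *)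
Lemma harmonic_const u : (forall x, laplacian c u x = 0) ->
  forall x y, u x = u y.
Proof.
move=> u0 x y.
have : dirichlet c u u == 0.
  by rewrite green big1// => z _; rewrite u0 mulr0.
rewrite mulf_eq0 invr_eq0 pnatr_eq0/= psumr_eq0; last first.
  by move=> z _; apply: sumr_ge0 => *; exact: dirichlet_term_ge0.
move=> /allP e0.
have edge p q : c p q != 0 -> u p = u q.
  move=> cpq; have := e0 p (mem_index_enum p).
  rewrite /= psumr_eq0; last by move=> *; exact: dirichlet_term_ge0.
  move=> /allP/(_ q (mem_index_enum q))/=.
  by rewrite !mulf_eq0 (negbTE cpq) orbF orbb subr_eq0 => /eqP.
have /connectP[s sp ->] := c_connected x y.
elim: s x sp => //= z s IHs x /andP[/andP[_ /edge ->]]; exact: IHs.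
Qed.

(** Fredholm alternative: the matrix L of the Laplacian is symmetric, so its row
space is the annihilator of its kernel, which consists of constants; a function
of zero sum is orthogonal to constants. *)
Lemma poisson_solvable v : \sum_x v x = 0 ->
  exists w, forall x, laplacian c w x = v x.
Proof.
move=> v0.
pose L : 'M[R]_#|X| := \matrix_(i, j)
  ((i == j)%:R * (\sum_y c (enum_val j) y) - c (enum_val j) (enum_val i)).
have LE (u : 'rV_#|X|) x :
    (u *m L) 0 (enum_rank x) = laplacian c (fun y => u 0 (enum_rank y)) x.
  rewrite mxE /laplacian.
  under [RHS]eq_bigr do rewrite mulrBl.
  rewrite sumrB -mulr_sumr.
  under eq_bigr do rewrite mxE enum_rankK mulrBr.
  rewrite sumrB; congr (_ - _).
    rewrite (bigD1 (enum_rank x))//= eqxx mul1r [X in _ + X]big1 ?addr0//.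
    by move=> i /negbTE->; rewrite mul0r mulr0.
  rewrite (reindex (@enum_rank X)) /=; last first.
    by apply: onW_bij; exact: enum_rank_bij.
  by apply: eq_bigr => y _; rewrite enum_rankK.
have Lsym : L^T = L.
  apply/matrixP => i j; rewrite !mxE conductance_sym eq_sym.
  by have [->|] := eqVneq i j; rewrite // !mul0r.
pose vv : 'rV[R]_#|X| := \row_i v (enum_val i).
suff /submxP[w wE] : (vv <= L)%MS.
  exists (fun y => w 0 (enum_rank y)) => x.
  by rewrite -LE -wE mxE enum_rankK.
(* Membership in the row space is tested against the columns of [cokermx L],
   each of which is harmonic. *)
rewrite submxE; apply/eqP/rowP => j.
pose u := (col j (cokermx L))^T.
have uL : u *m L = 0.
  by rewrite /u tr_col -{2}Lsym -row_mul -trmx_mul mulmx_coker trmx0 row0.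
have uc := @harmonic_const (fun y => u 0 (enum_rank y)).
have {}uc x y : u 0 (enum_rank x) = u 0 (enum_rank y).
  by apply: uc => z; rewrite -LE uL mxE.
rewrite !mxE.
have [x|X0] := pickP (@predT X); last first.
  by rewrite big1// => i _; have := X0 (enum_val i).
move=> _; rewrite (reindex (@enum_rank X)) /=; last first.
  by apply: onW_bij; exact: enum_rank_bij.
transitivity (\sum_y v y * u 0 (enum_rank x)); last first.
  by rewrite -mulr_suml v0 mul0r.
apply: eq_bigr => y _; rewrite (uc x y) /u mxE enum_rankK; congr (_ * _).
by rewrite !mxE.
Qed.

End Network.
End DirichletForm.

(** * States and their distances *)

Section States.
Import Order.TTheory GRing.Theory Num.Theory.
Local Open Scope complex_scope.
Local Open Scope ring_scope.
Context {R : realType} {X : finType}.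
Implicit Types (c : X -> X -> R) (m n w : X -> R) (mu nu : functional R X).

Definition has_weights mu m : Prop :=
  forall f : {ffun X -> R[i]}, mu f = \sum_x f x * (m x)%:C.

Definition point_mass (p x : X) : R := (x == p)%:R.

Lemma evaluation_weights p : has_weights (evaluation p) (point_mass p).
Proof.
move=> f; rewrite (bigD1 p)//= big1 => [|x /negbTE xp].
  by rewrite /point_mass eqxx mulr1 addr0.
by rewrite /point_mass xp mulr0.
Qed.

Lemma sum_point_mass_sub m (h : X -> R) x :
  \sum_y h y * (point_mass x y - m y) = h x - \sum_y h y * m y.
Proof.
under eq_bigr do rewrite mulrBr.
rewrite sumrB; congr (_ - _).
rewrite (bigD1 x)//= big1 => [|y /negbTE yx].
  by rewrite /point_mass eqxx mulr1 addr0.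
by rewrite /point_mass yx mulr0.
Qed.

Lemma state_weights mu : state_space mu ->
  exists m, [/\ forall x, 0 <= m x, \sum_x m x = 1 & has_weights mu m].
Proof.
move=> [mulin mupos mu1].
have mu0 : mu 0 = 0.
  by have := mulin (-1) 0 0; rewrite scaleN1r addNr mulN1r addNr.
pose bump x : {ffun X -> R[i]} := [ffun y => (y == x)%:R].
have bump0 x : 0 <= mu (bump x).
  by apply: mupos => y; rewrite ffunE; case: (y == x).
pose m x := complex.Re (mu (bump x)).
have mE x : mu (bump x) = (m x)%:C by rewrite RRe_real// ger0_real.
have muE : has_weights mu m.
  move=> f; have {1}-> : f = \sum_x f x *: bump x.
    apply/ffunP => y; rewrite sum_ffunE (bigD1 y)//= !ffunE eqxx.
    rewrite [X in _ + X]big1 => [|x xy]; first by rewrite addr0 [RHS]mulr1.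
    by rewrite !ffunE eq_sym (negbTE xy) [LHS]mulr0.
  apply: (big_ind2 (fun g r => mu g = r)) => //.
  - by move=> f1 r1 f2 r2 <- <-; have := mulin 1 f1 f2; rewrite scale1r mul1r.
  - move=> x _; rewrite -mE.
    by have := mulin (f x) (bump x) 0; rewrite addr0 mu0 addr0.
exists m; split=> // [x|]; first by rewrite -ler0c -mE.
apply: complexI; rewrite [RHS]/= -[RHS]mu1 muE rmorph_sum.
by apply: eq_bigr => x _; rewrite ffunE mul1r.
Qed.

(** Reduction to real functions: real and imaginary parts are orthogonal for the
energy because c is real. *)
Lemma energyE c (f : {ffun X -> R[i]}) :
  energy c f f =
    (dirichlet c (fun x => complex.Re (f x)) (fun x => complex.Re (f x))
     + dirichlet c (fun x => complex.Im (f x)) (fun x => complex.Im (f x)))%:C.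
Proof.
rewrite /energy /dirichlet -mulrDr rmorphM fmorphV rmorph_nat; congr (_ * _).
rewrite -big_split rmorph_sum; apply: eq_bigr => x _ /=.
rewrite -big_split rmorph_sum [RHS](bigID (fun y => x != y))/=.
rewrite [X in _ = _ + X]big1 ?addr0 => [|y /negPn/eqP <-]; last first.
  by rewrite !subrr !mul0r addr0.
apply: eq_bigr => y _.
case: (f x) (f y) => [a b] [a' b'] /=.
by apply/eqP; rewrite eq_complex /=; apply/andP; split; apply/eqP; ring.
Qed.

Lemma resistance_metricC c mu nu :
  resistance_metric c mu nu = resistance_metric c nu mu.
Proof.
congr (ereal_sup _ ^+ 2)%E; apply: eq_imagel => f _.
by rewrite -opprB normcN.
Qed.

Section Network.
Variable c : X -> X -> R.
Hypothesis c_network : resistance_network c.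

(** By Green's formula [mu f - nu f] is the inner product of f with w, so the
supremum is the dual norm of w: Cauchy-Schwarz bounds it by the norm of w, and
w scaled to the unit sphere attains the bound. *)
Lemma energy_metricE mu nu m n w : has_weights mu m -> has_weights nu n ->
    (forall x, laplacian c w x = m x - n x) ->
  energy_metric c mu nu = (Num.sqrt (dirichlet c w w))%:E.
Proof.
move=> mum nun wE.
have diffE (f : {ffun X -> R[i]}) : mu f - nu f =
    (dirichlet c (fun x => complex.Re (f x)) w)
    +i* (dirichlet c (fun x => complex.Im (f x)) w).
  rewrite mum nun -sumrB !green//.
  apply: (big_ind3 (fun z a b => z = a +i* b)) => // [_ a b _ a' b' -> ->|x _].
    by [].
  rewrite wE; case: (f x) => a b /=; apply/eqP; rewrite eq_complex /=.
  by apply/andP; split; apply/eqP; ring.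
have unitE (f : {ffun X -> R[i]}) : (sqrtC (energy c f f) <= 1) =
    (dirichlet c (fun x => complex.Re (f x)) (fun x => complex.Re (f x))
   + dirichlet c (fun x => complex.Im (f x)) (fun x => complex.Im (f x)) <= 1).
  rewrite energyE -(lecR _ 1) -[X in sqrtC _ <= X]sqrtC1 ler_sqrtC ?qualifE//=.
  by rewrite ler0c addr_ge0 ?dirichlet_ge0.
have D0 := dirichlet_ge0 c c_network w.
apply/eqP; rewrite eq_le; apply/andP; split.
  apply: ge_ereal_sup => _ [f /= fle <-]; rewrite lee_fin diffE /=.
  rewrite unitE in fle.
  apply: ler_wsqrtr; apply: (le_trans (lerD (cauchy_schwarz c c_network _ _)
    (cauchy_schwarz c c_network _ _))).
  by rewrite -mulrDl ler_piMl.
apply: ereal_sup_ubound => /=.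
set s := Num.sqrt _.
have sD : dirichlet c w w = s ^+ 2 by rewrite sqr_sqrtr.
(* When [s = 0] the convention [0^-1 = 0] gives [f = 0], which still attains
   the supremum. *)
pose f : {ffun X -> R[i]} := [ffun x => (s^-1 * w x)%:C].
have fRe : (fun x => complex.Re (f x)) = (fun x => s^-1 * w x).
  by apply/funext => x; rewrite ffunE.
have fIm : (fun x => complex.Im (f x)) = (fun x => 0 * w x).
  by apply/funext => x; rewrite ffunE mul0r.
exists f.
  rewrite unitE fRe fIm !dirichletZ mul0r addr0 dirichletC dirichletZ sD.
  have [->|s0] := eqVneq s 0; first by rewrite expr0n !mulr0.
  by rewrite expr2 mulKf// mulVf.
rewrite diffE fRe fIm !dirichletZ mul0r /= expr0n addr0 sD sqrtr_sqr.
have [->|s0] := eqVneq s 0; first by rewrite expr0n mulr0 normr0.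
by rewrite expr2 mulKf// ger0_norm// sqrtr_ge0.
Qed.

Lemma resistance_metricE mu nu m n w : has_weights mu m -> has_weights nu n ->
    (forall x, laplacian c w x = m x - n x) ->
  resistance_metric c mu nu = (dirichlet c w w)%:E.
Proof.
move=> mum nun wE.
rewrite /resistance_metric (energy_metricE _ _ _ _ _ mum nun wE).
by rewrite -EFin_expe sqr_sqrtr ?dirichlet_ge0.
Qed.

Hypothesis c_connected : connected_network c.

(** If no triangle with a vertex at mu and the other two at points of X has an
obtuse angle at mu, then mu is at distance 0 from a point: mu being a
barycentre, the inner products summed in [mean0] average to 0.  Here [g x]
represents the vector from mu to x. *)
Lemma triangles_through_state mu : state_space mu ->
    (forall x p, resistance_metric c (evaluation x) (evaluation p)
      <= resistance_metric c (evaluation x) mu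
         + resistance_metric c mu (evaluation p))%E ->
  exists p, resistance_metric c (evaluation p) mu = 0%E.
Proof.
move=> mustate tri.
have [m [m0 m1 mum]] := state_weights mu mustate.
have [p mp] : exists p, m p != 0.
  apply/existsP; apply: contraT => /existsPn H.
  move: m1; rewrite big1 => [/eqP|x _]; first by rewrite eq_sym oner_eq0.
  by apply/eqP; have := H x; rewrite negbK.
have pot x : exists w, forall y, laplacian c w y = point_mass x y - m y.
  apply: poisson_solvable => //.
  have := sum_point_mass_sub m (fun=> 1) x.
  by under eq_bigr do rewrite mul1r; under [X in _ - X]eq_bigr do rewrite mul1r;
    rewrite m1 subrr.
have [g gE] := choice pot.
have evm := evaluation_weights.
have dmu x : resistance_metric c (evaluation x) mu = (dirichlet c (g x) (g x))%:E.
  exact: (resistance_metricE _ _ _ _ _ (evm x) mum).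
exists p; rewrite dmu; congr (_%:E).
(* Law of cosines. *)
have angle_ge0 x : 0 <= dirichlet c (g x) (g p).
  have dxp : resistance_metric c (evaluation x) (evaluation p) =
     (dirichlet c (g x) (g x) + 2 * -1 * dirichlet c (g x) (g p)
       + (-1) ^+ 2 * dirichlet c (g p) (g p))%:E.
    rewrite -dirichlet_quad.
    apply: (resistance_metricE _ _ _ _ _ (evm x) (evm p)) => y.
    by rewrite laplacian_lin !gE; ring.
  have := tri x p.
  rewrite [resistance_metric c mu _]resistance_metricC !dmu dxp -EFinD lee_fin.
  lra.
have mean0 : \sum_x m x * dirichlet c (g x) (g p) = 0.
  under eq_bigr => x _.
    rewrite dirichletC green//; under eq_bigr do rewrite gE.
    rewrite sum_point_mass_sub mulrBr mulrC; over.
  by rewrite sumrB -mulr_suml m1 mul1r subrr.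
have /eqP := mean0; rewrite psumr_eq0 => [|x _]; last by rewrite mulr_ge0.
move=> /allP/(_ p (mem_index_enum p))/=.
by rewrite mulf_eq0 (negbTE mp) => /eqP.
Qed.

End Network.
End States.

Theorem proposition9p6 (R : realType) (X : finType) (c : X -> X -> R)
    (c_network : resistance_network c) (c_connected : connected_network c) :
  forall A : set (functional R X),
    A `<=` @state_space R X -> range (@evaluation R X) `<` A ->
    ~ metric_on A (resistance_metric c).
Proof.
move=> A AS [XA nAX] [_ dsep _ dtri]; apply: nAX => mu Amu.
have evA x : A (evaluation x) by apply: XA; exists x.
have [x p|p dp0] := triangles_through_state c c_network c_connected mu (AS _ Amu).
  exact: dtri.
by exists p => //; apply/(dsep _ _ (evA p) Amu).
Qed.
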